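(* Let $n,d,t$ be positive integers with $d,t\le n$, let $K$ be a field, and let $I=I_{n,d,t}\subset S=K[x_1,\ldots,x_n]$ be the $t$-spread Veronese ideal of degree $d$. Then for every $k\ge0$, $\operatorname{HS}_k(I)$ is the ideal generated by all monomials $x_{i_1}x_{i_2}\cdots x_{i_{d+k}}$ with $1\le i_1<i_2<\cdots<i_{d+k}\le n$ such that $i_{\ell+1}-i_\ell<t$ for at most $k$ integers $\ell$ (with $1\le\ell\le d+k-1$).
   Context: A monomial $x_{i_1}x_{i_2}\cdots x_{i_d}$ with $i_1\le i_2\le\cdots\le i_d$ is $t$-spread if $i_j-i_{j-1}\ge t$ for $2\le j\le d$. $I_{n,d,t}$ is the ideal of $S=K[x_1,\ldots,x_n]$ generated by all $t$-spread monomials of degree $d$. For a monomial ideal $I\subset S$ with minimal $\mathbb Z^n$-graded free resolution $\mathbb F\to I$, $F_i=\bigoplus_{j=1}^{b_i}S(-\mathbf a_{ij})$, the $i$th homological shift ideal is $\operatorname{HS}_i(I)=(\mathbf x^{\mathbf a_{ij}}: j=1,\ldots,b_i)$; so $\operatorname{HS}_0(I)=I$, and $\operatorname{HS}_i(I)=0$ if $F_i=0$. *)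

(* Defs.v *)
From HB Require Import structures.
From mathcomp Require Import all_boot all_order all_algebra.
From mathcomp Require Export mpoly.

Set Implicit Arguments.
Unset Strict Implicit.
Unset Printing Implicit Defensive.

Import GRing.Theory.
Local Open Scope ring_scope.

(* Ideals are predicates on {mpoly K[n]}; ideal_gen of the empty predicate is
   the zero ideal. *)
Definition ideal_gen (A : comNzRingType) (G : A -> Prop) (p : A) : Prop :=
  exists2 r : seq (A * A),
    (forall x, x \in r -> G x.2) & p = \sum_(x <- r) x.1 * x.2.

Definition max_ideal (K : fieldType) (n : nat) : {mpoly K[n]} -> Prop :=
  ideal_gen (fun q => exists i : 'I_n, q = 'X_i).

(* The data F_0 <- F_1 <- ... with F_i = \bigoplus_j S(- mg_shift i j) of rank
   mg_rank i, together with F_0 -> S.  Elements of F_i are row vectors, and maps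
   act by right multiplication: row j of mg_diff i is the image in F_i of the
   j-th basis vector of F_(i+1). *)
Record mg_complex (K : fieldType) (n : nat) := MgComplex {
  mg_rank : nat -> nat;
  mg_shift : forall i : nat, 'I_(mg_rank i) -> 'X_{1..n};
  mg_aug : 'cV[{mpoly K[n]}]_(mg_rank 0);
  mg_diff : forall i : nat, 'M[{mpoly K[n]}]_(mg_rank i.+1, mg_rank i)
}.

(* All maps are homogeneous of multidegree 0: the j-th basis vector of F_(i+1),
   of multidegree mg_shift (i+1) j, has an image of the same multidegree. *)
Definition mg_homogeneous (K : fieldType) (n : nat) (F : mg_complex K n) :
    Prop :=
  (forall j m, m \in msupp (mg_aug F j 0) -> m = mg_shift j) /\
  (forall i (j : 'I_(mg_rank F i.+1)) (l : 'I_(mg_rank F i)) m,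
     m \in msupp (mg_diff F i j l) -> (m + mg_shift l)%MM = mg_shift j).

(* ... -> F_1 -> F_0 -> I -> 0 is exact. *)
Definition mg_exact (K : fieldType) (n : nat) (F : mg_complex K n)
    (I : {mpoly K[n]} -> Prop) : Prop :=
  [/\ forall p, I p <->
        exists v : 'rV[{mpoly K[n]}]_(mg_rank F 0), (v *m mg_aug F) 0 0 = p,
      forall v : 'rV[{mpoly K[n]}]_(mg_rank F 0),
        v *m mg_aug F = 0 <-> exists w, v = w *m mg_diff F 0
    & forall i (v : 'rV[{mpoly K[n]}]_(mg_rank F i.+1)),
        v *m mg_diff F i = 0 <-> exists w, v = w *m mg_diff F i.+1].

(* The image of F_(i+1) lies in (x_1, ..., x_n) F_i. *)
Definition mg_minimal (K : fieldType) (n : nat) (F : mg_complex K n) : Prop :=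
  forall i (j : 'I_(mg_rank F i.+1)) (l : 'I_(mg_rank F i)),
    max_ideal (mg_diff F i j l).

Definition minimal_mg_free_resolution (K : fieldType) (n : nat)
    (F : mg_complex K n) (I : {mpoly K[n]} -> Prop) : Prop :=
  [/\ mg_homogeneous F, mg_exact F I & mg_minimal F].

(* HS_i(I), read off a minimal multigraded free resolution F of I. *)
Definition homological_shift_ideal (K : fieldType) (n : nat)
    (F : mg_complex K n) (i : nat) : {mpoly K[n]} -> Prop :=
  ideal_gen (fun q => exists j : 'I_(mg_rank F i), q = 'X_[mg_shift j]).

Definition seq_monomial (K : fieldType) (n : nat) (s : seq 'I_n) :
  {mpoly K[n]} := \prod_(i <- s) 'X_i.

Definition t_spread (n t : nat) (s : seq 'I_n) : bool :=
  sorted (fun i j : 'I_n => (i <= j)%N && (t <= j - i)%N) s.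

Definition veronese_ideal (K : fieldType) (n d t : nat) :
    {mpoly K[n]} -> Prop :=
  ideal_gen (fun q => exists s : seq 'I_n,
    [/\ size s = d, t_spread t s & q = seq_monomial K s]).

(* The number of l with s_(l+1) - s_l < t, for s = (s_0, s_1, ...) increasing. *)
Definition small_gaps (n t : nat) (s : seq 'I_n) : nat :=
  let v := map val s in
  count (fun l => nth 0 v l.+1 - nth 0 v l < t)%N (iota 0 (size s).-1).

Definition few_small_gaps_ideal (K : fieldType) (n d t k : nat) :
    {mpoly K[n]} -> Prop :=
  ideal_gen (fun q => exists s : seq 'I_n,
    [/\ size s = (d + k)%N, sorted (fun i j : 'I_n => (i < j)%N) s,
        (small_gaps t s <= k)%N & q = seq_monomial K s]).

(* Main.v *)
Require Import Defs.
From mathcomp Require Import all_boot all_order all_algebra zify.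

(** In each multidegree, a multigraded complex of free modules is a complex of
    finite-dimensional vector spaces with bases taken from the basis of the
    free modules, and its maps are given by scalar matrices which do not depend
    on the multidegree.  For a multidegree b and a set T of variables let
    region b T be the set of the multidegrees m <= b that agree with b on T.
    The basis vectors of F with multidegree in region b T span the strand of
    degree b of F / (x_i : i in T) F, so the homology of this subquotient is
    the degree b part of Tor(I, S / (x_i : i in T)).
    - For T empty this is the degree b part of I, in homological degree 0.
    - For T the set of all variables all the maps vanish, by minimality; thus
      the subquotient is acyclic in homological degree k exactly when F_k has
      no basis vector of multidegree b ([acyclic_setT]).
    - For i outside T with b_i > 0, region b T is the disjoint union of
      region b (i |: T) and region (b - U_(i)) T, which gives a short exact
      sequence of complexes.  The parts of its long exact sequence that are
      needed are [acyclic_mid], [acyclic_quo] and [acyclic_sub].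
    - If multiplication by x_q does not affect membership in I for the
      relevant monomials, the complex is acyclic ([acyclic_cone]).

    The variables are divided out starting from the last one.  A monomial lies
    in I when the greedy algorithm, which reads the support from left to right,
    finds d positions at mutual distance at least t ([spread_pickP]).  When
    the variables x_q, ..., x_(n-1) have been divided out, all that matters of
    the exponents of b before q is the state (lb, d') of that algorithm: d'
    positions remain to be found, from lb on.  By descending induction on q,
    the homology in degree k is nonzero exactly when b is squarefree from q on
    and its support from q on satisfies a recursive condition [tor_shape]
    ([acyclic_upper]).  That condition forces the size of the support to be
    d' + k, so that the subcomplex and the middle term of each short exact
    sequence never have homology in the same degree, and no cancellation can
    occur.  For q = 0 the condition says that the support has d + k elements
    and at most k small gaps ([tor_shape_gapsE]).  Hence the multidegrees of the basis vectors of F_k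
    are exactly those of the monomials in the theorem. *)

Set Implicit Arguments.
Unset Strict Implicit.
Unset Printing Implicit Defensive.

(** * Greedy selection of spread subsequences, and gaps *)

(** Whether the greedy algorithm finds, in the increasing sequence l, d elements
    at mutual distance at least t, all at least lb. *)
Fixpoint spread_pick (t lb d : nat) (l : seq nat) : bool :=
  if l is x :: l' then
    (d == 0) || (if lb <= x then spread_pick t (x + t) d.-1 l'
                 else spread_pick t lb d l')
  else d == 0.

(** The recursion produced by the long exact sequences: in state (lb, d), the
    supports l for which the homology in degree k is nonzero.  The first element
    x of l must be available to the greedy algorithm.  The two alternatives are
    the contributions to the quotient of the middle term, where x is picked,
    and of the subcomplex, where x is removed from the support and the
    homological degree drops by 1. *)
Fixpoint tor_shape (t lb d k : nat) (l : seq nat) : bool :=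
  if l is x :: l' then
    [&& 0 < d, lb <= x
      & tor_shape t (x + t) d.-1 k l' || (0 < k) && tor_shape t lb d k.-1 l']
  else (d == 0) && (k == 0).

(** The number of consecutive pairs of l at distance less than t. *)
Fixpoint short_gaps (t : nat) (l : seq nat) : nat :=
  if l is x :: l' then
    (if l' is y :: _ then (y - x < t) : nat else 0) + short_gaps t l'
  else 0.

Lemma tor_shape_size t lb d k l : tor_shape t lb d k l -> size l = d + k.
Proof.
elim: l lb d k => [|x l IH] lb d k /=; first by case/andP=> /eqP-> /eqP->.
case/and3P=> d0 _ /orP[/IH|/andP[k0 /IH]] ->; first by rewrite -addSn prednK.
by rewrite -addnS prednK.
Qed.

Lemma short_gaps_le t l : short_gaps t l <= (size l).-1.
Proof.
elim: l => [|x [|y l] IH] //; rewrite [X in X <= _]/= -/(short_gaps t (y :: l)).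
by rewrite -[(size _).-1]add1n leq_add // leq_b1.
Qed.

(** If the first gap is short then picking the first element makes the second
    one unavailable, so the first element must be removed, which lowers k and the
    number of short gaps together.  If it is long both alternatives may occur,
    and the number of short gaps is unchanged. *)
Lemma tor_shape_gapsE t lb d k l : 0 < d -> sorted ltn l -> all (leq lb) l ->
  tor_shape t lb d k l = (size l == d + k) && (short_gaps t l <= k).
Proof.
elim: l lb d k => [|x l IH] lb d k d0; first by case: d d0.
move=> lS /= /andP[lbx lbl]; rewrite d0 lbx /=.
have lS' : sorted ltn l := path_sorted lS.
rewrite (IH lb d k.-1 d0 lS' lbl).
case: l => [|y l] in IH lS lbl lS' *; first by rewrite /=; lia.
have xy : x < y by case/andP: lS.
have ally : all (leq y) (y :: l).
  rewrite /= leqnn /=; apply: sub_all (order_path_min ltn_trans lS') => z.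
  exact: ltnW.
have gs := short_gaps_le t (y :: l); have sz : 0 < size (y :: l) by [].
move: (short_gaps t (y :: l)) (size (y :: l)) gs sz IH => g s gs sz IH.
case: (ltnP (y - x) t) => yx.
  have -> : tor_shape t (x + t) d.-1 k (y :: l) = false by rewrite /=; lia.
  by lia.
have leyx : x + t <= y by lia.
have [d1|d1] := ltnP 1 d.
  rewrite IH ?lS' //; [by lia | by lia |].
  by apply: sub_all ally => z; apply: leq_trans leyx.
have -> : tor_shape t (x + t) d.-1 k (y :: l) = false by rewrite /=; lia.
by lia.
Qed.

(** Correctness of the greedy algorithm: in any admissible selection, the first
    element can be exchanged for the least available one. *)
Lemma spread_pickP t lb d l : 0 < t -> sorted ltn l ->
  reflect (exists s, [/\ size s = d, sorted (fun x y => x + t <= y) s,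
                        all (leq lb) s & {subset s <= l}])
          (spread_pick t lb d l).
Proof.
move=> t_gt0 lS; apply: (iffP idP) => [|[s []]].
  elim: l lb d lS => [|x l IH] lb d lS /=.
    by move=> /eqP->; exists [::].
  case/orP=> [/eqP->|]; first by exists [::].
  have [lbx|_] := leqP lb x => /IH[|s [sd sS slb sl]];
    rewrite ?(path_sorted lS) //.
    case: d sd => [|d] sd; first by exists [::].
    exists (x :: s); split; rewrite /= ?sd //.
    - by case: s {sd sl} sS slb => //= y s -> /andP[->].
    - by rewrite lbx; apply: sub_all slb => z; apply: leq_trans; lia.
    - by move=> z; rewrite !inE => /orP[->//|/sl->]; rewrite orbT.
  by exists s; split=> // z /sl; rewrite inE orbC => ->.
elim: l lb d s lS => [|x l IH] lb d s lS sd sS slb sl /=.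
  rewrite -sd; case: s sl {sd sS slb} => // y s /(_ y).
  by rewrite mem_head => /(_ isT).
have lgt z : z \in l -> x < z by apply: (allP (order_path_min ltn_trans lS)).
have lS' : sorted ltn l := path_sorted lS.
case: s => [|y s] in sd sS slb sl *; first by rewrite -sd.
rewrite -sd /=; have xy : x <= y.
  by have := sl y (mem_head _ _); rewrite inE => /predU1P[->//|/lgt/ltnW].
have sgt z : z \in s -> y + t <= z.
  have tr : transitive (fun a b => a + t <= b) by move=> a b c; lia.
  by apply: (allP (order_path_min tr sS)).
have sl' : {subset s <= l}.
  move=> z zs; have := sl z; rewrite !inE zs orbT => /(_ isT) /predU1P[zx|//].
  by have := sgt z zs; lia.
have [lbx|lbx] := leqP lb x.
  (* x takes the place of the first element y of the selection *)
  apply: (IH _ _ s) => //; first exact: path_sorted sS.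
  by apply/allP=> z /sgt; rewrite /=; lia.
apply: (IH _ _ (y :: s)) => // z; rewrite inE => /predU1P[->|/sl'//].
have := sl y (mem_head _ _); rewrite inE => /predU1P[yx|//].
by move: slb => /= /andP[+ _]; lia.
Qed.

(** * Supports of multidegrees *)

(** The support of b within the variables of index at least q, in increasing
    order. *)
Definition supp_from n (b : 'X_{1..n}) (q : nat) : seq nat :=
  [seq x <- iota q (n - q) | 0 < nth 0 b x].

Lemma eq_supp_from n (b b' : 'X_{1..n}) q :
  (forall i : 'I_n, q <= i -> (0 < b i) = (0 < b' i)) ->
  supp_from b q = supp_from b' q.
Proof.
move=> eq_bb'; apply: eq_in_filter => x; rewrite mem_iota => /andP[qx xn].
have lt_xn : x < n by lia.
by have := eq_bb' (Ordinal lt_xn) qx; rewrite !(mnm_nth 0).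
Qed.

Lemma supp_from_end n (b : 'X_{1..n}) : supp_from b n = [::].
Proof. by rewrite /supp_from subnn. Qed.

Lemma supp_from_cons n (b : 'X_{1..n}) (i : 'I_n) :
  supp_from b i =
    if 0 < b i then val i :: supp_from b i.+1 else supp_from b i.+1.
Proof. by rewrite /supp_from -[n - i]prednK ?subn_gt0 //= -subnS -mnm_nth. Qed.

Lemma supp_from_sorted n (b : 'X_{1..n}) q : sorted ltn (supp_from b q).
Proof. exact/sorted_filter/iota_ltn_sorted/ltn_trans. Qed.

Lemma mem_supp_from n (b : 'X_{1..n}) q (i : 'I_n) :
  (i : nat) \in supp_from b q = (q <= i) && (0 < b i).
Proof.
rewrite mem_filter mem_iota -mnm_nth andbC; congr (_ && _).
by case: i => i /= lt_in; lia.
Qed.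

(** The exponents of b on the variables of index at least q are at most 1. *)
Definition sqfree_from n (b : 'X_{1..n}) (q : nat) : bool :=
  [forall i : 'I_n, (q <= i) ==> (b i <= 1)].

Lemma sqfree_fromS n (b : 'X_{1..n}) (q : 'I_n) :
  sqfree_from b q = (b q <= 1) && sqfree_from b q.+1.
Proof.
apply/forallP/andP=> [h|[bq /forallP h] i]; last first.
  apply/implyP; rewrite leq_eqVlt => /predU1P[/val_inj<-//|qi].
  by have /implyP := h i; apply.
split; first by have := h q; rewrite leqnn.
by apply/forallP=> i; apply/implyP=> /ltnW; have /implyP := h i.
Qed.

Lemma eq_sqfree_from n (b b' : 'X_{1..n}) q :
  (forall i : 'I_n, q <= i -> b i = b' i) -> sqfree_from b q = sqfree_from b' q.
Proof.
move=> eqb; apply: eq_forallb => i.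
by case: leqP => //= qi; rewrite eqb.
Qed.

(** * Subquotients of the strands of a scalar complex *)

Import GRing.Theory.
Local Open Scope ring_scope.

Section Strands.

(** A complex of scalar matrices C i whose basis vectors carry multidegrees; a
    nonzero entry may only lead from a multidegree to a smaller one.  Vectors
    are rows, and maps act by right multiplication. *)
Variables (K : fieldType) (n : nat) (rk : nat -> nat).
Variable sh : forall i, 'I_(rk i) -> 'X_{1..n}.
Variable C : forall i, 'M[K]_(rk i.+1, rk i).
Hypothesis C_homog : forall i j l, C i j l != 0 -> (sh l <= sh j)%MM.
Hypothesis CC0 : forall i, C i.+1 *m C i = 0.

Implicit Type Q : pred 'X_{1..n}.

(** The projection on the basis vectors with multidegree in Q. *)
Definition cut Q i : 'M[K]_(rk i) := diag_mx (\row_j (Q (sh j))%:R).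

(** The map out of level i; at level 0 it is zero, so that the complex is not
    augmented.  Its target is level i.-1, which for i = 0 is again level 0. *)
Definition bdry i : 'M[K]_(rk i, rk i.-1) :=
  match i return 'M[K]_(rk i, rk i.-1) with 0 => 0 | k.+1 => C k end.

(** Exactness at level i of the complex on the basis vectors with multidegree in
    Q, with the maps obtained from C by projection. *)
Definition acyclic_at Q i :=
  forall v : 'rV[K]_(rk i), v *m cut Q i = v -> v *m bdry i *m cut Q i.-1 = 0 ->
  exists2 w : 'rV[K]_(rk i.+1), w *m cut Q i.+1 = w & v = w *m C i *m cut Q i.

Lemma bdry_homog i j l : bdry i j l != 0 -> (sh l <= sh j)%MM.
Proof. by case: i j l => [|i] j l /=; [rewrite mxE eqxx | apply: C_homog]. Qed.

Lemma C_bdry0 i : C i *m bdry i = 0.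
Proof. by case: i => [|i]; [exact: mulmx0 | exact: CC0]. Qed.

Lemma mul_cutE Q i m (A : 'M[K]_(m, rk i)) r j :
  (A *m cut Q i) r j = A r j * (Q (sh j))%:R.
Proof. by rewrite mul_mx_diag !mxE. Qed.

Lemma cut_mulE Q i m (A : 'M[K]_(rk i, m)) j r :
  (cut Q i *m A) j r = (Q (sh j))%:R * A j r.
Proof. by rewrite mul_diag_mx !mxE. Qed.

Lemma cutP Q i (v : 'rV[K]_(rk i)) :
  v *m cut Q i = v <-> (forall j, ~~ Q (sh j) -> v 0 j = 0).
Proof.
split=> [<- j /negPf Qj|v0]; first by rewrite mul_cutE Qj mulr0.
apply/rowP=> j; rewrite mul_cutE; case: (boolP (Q _)) => [_|/v0 ->].
  by rewrite mulr1.
by rewrite mul0r.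
Qed.

Lemma eq_cut Q Q' i : Q =1 Q' -> cut Q i = cut Q' i.
Proof. by move=> eQ; congr diag_mx; apply/rowP=> j; rewrite !mxE eQ. Qed.

Lemma eq_acyclic Q Q' i : Q =1 Q' -> acyclic_at Q i -> acyclic_at Q' i.
Proof.
by move=> eQ; rewrite /acyclic_at !(eq_cut _ eQ).
Qed.

Lemma cutK Q i : cut Q i *m cut Q i = cut Q i.
Proof.
apply/matrixP=> j l; rewrite mul_cutE !mxE.
case: (j =P l) => [->|]; case: (Q _);
  by rewrite ?(mulr0n, mulr1n, mulr0, mulr1, mul0r).
Qed.

Lemma mul_cut_id Q i m (A : 'M[K]_(m, rk i)) :
  A *m cut Q i *m cut Q i = A *m cut Q i.
Proof. by rewrite -mulmxA cutK. Qed.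

(** For such Q the projected maps form a complex, a subquotient of the given
    one. *)
Definition order_convex Q := forall m1 m m2,
  Q m1 -> Q m2 -> (m1 <= m)%MM -> (m <= m2)%MM -> Q m.

Lemma cut_bdry0 Q i : order_convex Q ->
  cut Q i.+1 *m C i *m cut Q i *m bdry i *m cut Q i.-1 = 0.
Proof.
move=> convQ; apply/matrixP=> j l; rewrite mul_cutE mxE [RHS]mxE.
have [Ql|] := boolP (Q (sh l)); last by rewrite mulr0.
have [Qj|Qj] := boolP (Q (sh j)); last first.
  rewrite big1 ?mul0r // => x _.
  by rewrite mul_cutE cut_mulE (negPf Qj) !mul0r.
rewrite mulr1; have /matrixP/(_ j l) := C_bdry0 i.
rewrite mxE [RHS]mxE; apply: etrans; apply: eq_bigr => x _.
rewrite mul_cutE cut_mulE Qj mul1r.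
have [->|/C_homog lexj] := eqVneq (C i j x) 0; first by rewrite !mul0r.
have [->|/bdry_homog lelx] := eqVneq (bdry i x l) 0; first by rewrite !mulr0.
by rewrite (convQ (sh l) (sh x) (sh j)) ?mulr1.
Qed.

Section Split.

(** Q is the disjoint union of Q1 and Q2, and nothing in Q1 lies below anything
    in Q2.  Then Q2 spans a subcomplex of the complex on Q, with quotient the
    complex on Q1. *)
Variables Q Q1 Q2 : pred 'X_{1..n}.
Hypothesis Q_split : Q =1 predU Q1 Q2.
Hypothesis Q12 : forall m, Q1 m -> Q2 m -> false.
Hypothesis Q21 : forall m1 m2, Q1 m1 -> Q2 m2 -> (m1 <= m2)%MM -> false.
Hypothesis convQ : order_convex Q.

Lemma cut_split i : cut Q i = cut Q1 i + cut Q2 i.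
Proof.
apply/matrixP=> j l; rewrite !mxE Q_split /= -mulrnDl; congr (_ *+ _).
case E1: (Q1 _); case E2: (Q2 _); rewrite ?addr0 ?add0r //.
by have := Q12 E1 E2.
Qed.

Lemma cut12 i : cut Q1 i *m cut Q2 i = 0.
Proof.
apply/matrixP=> j l; rewrite mul_cutE !mxE.
case: (j =P l) => [->|_]; last by rewrite mulr0n mul0r.
case E1: (Q1 _); case E2: (Q2 _); rewrite ?mulr0 ?mul0rn ?mul0r //.
by have := Q12 E1 E2.
Qed.

Lemma cut21 i : cut Q2 i *m cut Q1 i = 0.
Proof. by apply: trmx_inj; rewrite trmx_mul !tr_diag_mx cut12 trmx0. Qed.

Lemma cut2_bdry_cut1 i m (A : 'M[K]_(m, rk i)) :
  A *m cut Q2 i *m bdry i *m cut Q1 i.-1 = 0.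
Proof.
suff: cut Q2 i *m bdry i *m cut Q1 i.-1 = 0.
  by move/(congr1 (mulmx A)); rewrite mulmx0 !mulmxA.
apply/matrixP=> j l; rewrite mul_cutE cut_mulE [RHS]mxE.
have [->|/bdry_homog le_lj] := eqVneq (bdry i j l) 0.
  by rewrite mulr0 mul0r.
case E1: (Q1 _); case E2: (Q2 _); rewrite ?mulr0 ?mul0r //.
by have := Q21 E1 E2 le_lj.
Qed.

Lemma cut2_C_cut1 i m (A : 'M[K]_(m, rk i.+1)) :
  A *m cut Q2 i.+1 *m C i *m cut Q1 i = 0.
Proof. exact: (cut2_bdry_cut1 (i := i.+1)). Qed.

Let cutl1 i m (A : 'M[K]_(m, rk i)) : A *m cut Q i *m cut Q1 i = A *m cut Q1 i.
Proof. by rewrite -mulmxA cut_split mulmxDl cutK cut21 addr0. Qed.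

Let cut1l i m (A : 'M[K]_(m, rk i)) : A *m cut Q1 i *m cut Q i = A *m cut Q1 i.
Proof. by rewrite -mulmxA cut_split mulmxDr cutK cut12 addr0. Qed.

Let cut2l i m (A : 'M[K]_(m, rk i)) : A *m cut Q2 i *m cut Q i = A *m cut Q2 i.
Proof. by rewrite -mulmxA cut_split mulmxDr cutK cut21 add0r. Qed.

Let on1 i (v : 'rV[K]_(rk i)) : v *m cut Q1 i = v -> v *m cut Q i = v.
Proof. by move=> <-; rewrite cut1l. Qed.

Let on2 i (v : 'rV[K]_(rk i)) : v *m cut Q2 i = v -> v *m cut Q i = v.
Proof. by move=> <-; rewrite cut2l. Qed.

Let bd2 i (v : 'rV[K]_(rk i)) : v *m cut Q2 i = v ->
  v *m bdry i *m cut Q i.-1 = v *m bdry i *m cut Q2 i.-1.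
Proof.
by move=> <-; rewrite cut_split mulmxDr cut2_bdry_cut1 add0r.
Qed.

Let bd1 i (v : 'rV[K]_(rk i)) :
  v *m bdry i *m cut Q i.-1 = 0 -> v *m cut Q i = v ->
  v *m cut Q1 i *m bdry i *m cut Q1 i.-1 = 0.
Proof.
move=> v0 vQ; have -> : v *m cut Q1 i = v - v *m cut Q2 i.
  by rewrite -{2}vQ cut_split mulmxDr addrK.
by rewrite !mulmxBl cut2_bdry_cut1 -cutl1 v0 mul0mx subr0.
Qed.

Let bdbd i (w : 'rV[K]_(rk i.+1)) : w *m cut Q i.+1 = w ->
  w *m C i *m cut Q i *m bdry i *m cut Q i.-1 = 0.
Proof.
move=> <-; have := congr1 (mulmx w) (cut_bdry0 i convQ).
by rewrite mulmx0 !mulmxA.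
Qed.

(** The long exact sequence of the subcomplex on Q2, the complex on Q and the
    quotient on Q1: acyclicity of the neighbours of a term implies that of the
    term itself. *)
Lemma acyclic_mid i : acyclic_at Q1 i -> acyclic_at Q2 i -> acyclic_at Q i.
Proof.
move=> ac1 ac2 v vQ v0.
have [w1 w1Q Ew1] := ac1 _ (mul_cut_id _ _) (bd1 v0 vQ).
pose u := v - w1 *m C i *m cut Q i.
have uQ : u *m cut Q i = u by rewrite mulmxBl vQ mul_cut_id.
have u1 : u *m cut Q1 i = 0 by rewrite mulmxBl cutl1 Ew1 subrr.
have u2 : u *m cut Q2 i = u.
  by rewrite -{2}uQ cut_split mulmxDr u1 add0r.
have ub : u *m bdry i *m cut Q2 i.-1 = 0.
  by rewrite -bd2 // !mulmxBl v0 bdbd ?subr0 // on1.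
have [w2 w2Q Ew2] := ac2 _ u2 ub.
exists (w1 + w2); first by rewrite mulmxDl (on1 w1Q) (on2 w2Q).
by rewrite !mulmxDl (bd2 (i := i.+1) w2Q) -Ew2 addrC subrK.
Qed.

Lemma acyclic_quo i :
  acyclic_at Q i.+1 -> acyclic_at Q2 i -> acyclic_at Q1 i.+1.
Proof.
move=> ac ac2 v v1 v0.
pose u := v *m C i *m cut Q i.
have u1 : u *m cut Q1 i = 0 by rewrite cutl1.
have uQ : u *m cut Q i = u by rewrite mul_cut_id.
have u2 : u *m cut Q2 i = u by rewrite -{2}uQ cut_split mulmxDr u1 add0r.
have ub : u *m bdry i *m cut Q2 i.-1 = 0 by rewrite -bd2 // bdbd // on1.
have [w w2 Ew] := ac2 _ u2 ub.
have [||x xQ Ex] := ac (v - w); first by rewrite mulmxBl (on1 v1) (on2 w2).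
  by rewrite /= !mulmxBl -/u (bd2 (i := i.+1) w2) -Ew subrr.
exists (x *m cut Q1 _); first exact: mul_cut_id.
have -> : x *m cut Q1 i.+2 = x - x *m cut Q2 i.+2.
  by rewrite -{2}xQ cut_split mulmxDr addrK.
rewrite !mulmxBl cut2_C_cut1 subr0 -cutl1 -Ex.
by rewrite mulmxBl v1 -w2 -mulmxA cut21 mulmx0 subr0.
Qed.

Lemma acyclic_quo0 : acyclic_at Q 0 -> acyclic_at Q1 0.
Proof.
move=> ac v v1 _; have [|x xQ Ex] := ac v (on1 v1).
  by rewrite mulmx0 mul0mx.
exists (x *m cut Q1 _); first exact: mul_cut_id.
have -> : x *m cut Q1 1%N = x - x *m cut Q2 1%N.
  by rewrite -{2}xQ cut_split mulmxDr addrK.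
rewrite !mulmxBl cut2_C_cut1 subr0 -cutl1 -Ex.
by rewrite v1.
Qed.

Lemma acyclic_sub i : acyclic_at Q1 i.+1 -> acyclic_at Q i -> acyclic_at Q2 i.
Proof.
move=> ac1 ac v v2 v0.
have [||w wQ Ew] := ac v; [exact: on2 | by rewrite bd2 |].
have w1 : w *m cut Q1 i.+1 *m C i *m cut Q1 i = 0.
  have -> : w *m cut Q1 i.+1 = w - w *m cut Q2 i.+1.
    by rewrite -{2}wQ cut_split mulmxDr addrK.
  rewrite !mulmxBl cut2_C_cut1 subr0 -cutl1 -Ew.
  by rewrite -v2 -mulmxA cut21 mulmx0.
have [x x1 Ex] := ac1 _ (mul_cut_id _ _) w1.
pose u := w - x *m C i.+1 *m cut Q i.+1.
have uQ : u *m cut Q i.+1 = u by rewrite mulmxBl wQ mul_cut_id.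
have u1 : u *m cut Q1 i.+1 = 0 by rewrite mulmxBl cutl1 -Ex subrr.
have u2 : u *m cut Q2 i.+1 = u.
  by rewrite -{2}uQ cut_split mulmxDr u1 add0r.
exists u => //; rewrite -(bd2 (i := i.+1) u2) /= !mulmxBl -Ew.
by rewrite (bdbd (i := i.+1)) ?subr0 // on1.
Qed.

End Split.

(** The multidegrees below b that agree with b on T.  The complex on region b T
    is the strand of degree b of the reduction modulo the variables in T. *)
Definition region (b : 'X_{1..n}) (T : {set 'I_n}) : pred 'X_{1..n} :=
  fun m => (m <= b)%MM && [forall i in T, m i == b i].

Lemma regionP (b : 'X_{1..n}) (T : {set 'I_n}) (m : 'X_{1..n}) :
  reflect ((forall i, m i <= b i)%N /\ (forall i, i \in T -> m i = b i))
          (region b T m).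
Proof.
apply: (iffP andP) => -[mb mT]; split.
- by move=> i; apply: (mnm_lepP mb).
- by move=> i iT; apply/eqP; apply: (forall_inP mT).
- exact/mnm_lepP.
- by apply/forall_inP=> i iT; rewrite mT.
Qed.

Lemma region_convex b T : order_convex (region b T).
Proof.
move=> m1 m m2 /regionP[_ h1] /regionP[b2 h2] /mnm_lepP le1 /mnm_lepP le2.
apply/regionP; split=> i; first exact: leq_trans (le2 i) (b2 i).
by move=> iT; apply/eqP; rewrite eqn_leq -{1}(h2 i iT) le2 -(h1 i iT) le1.
Qed.

Lemma region_eq0 (b : 'X_{1..n}) (T : {set 'I_n}) i : b i = 0%N ->
  region b (i |: T) =1 region b T.
Proof.
move=> bi0 m; apply/regionP/regionP=> -[mb mT]; split=> // j jT.
  by apply: mT; rewrite in_setU1 jT orbT.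
move: jT; rewrite in_setU1 => /orP[/eqP->|/mT//].
by apply/eqP; rewrite bi0 -leqn0 -bi0.
Qed.

Section RegionSplit.

Variables (b : 'X_{1..n}) (T : {set 'I_n}) (i : 'I_n).
Hypotheses (iT : i \notin T) (bi_gt0 : (0 < b i)%N).

Lemma region_split :
  region b T =1 predU (region b (i |: T)) (region (b - U_(i))%MM T).
Proof.
move=> m; apply/regionP/orP=> [[mb mT]|[]/regionP[mb mT]].
- have [mi|mi] := eqVneq (m i) (b i); [left|right]; apply/regionP; split=> //.
  + by move=> j; rewrite in_setU1 => /orP[/eqP->|/mT].
  + move=> j; rewrite mnmBE mnm1E; case: eqP => [<-|_]; last by rewrite subn0.
    by rewrite subn1 -ltnS prednK // ltn_neqAle mi mb.
  + move=> j jT; rewrite mnmBE mnm1E mT //; case: eqP => [ij|_].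
      by have := iT; rewrite ij jT.
    by rewrite subn0.
- by split=> // j jT; apply: mT; rewrite in_setU1 jT orbT.
- split=> j.
    by apply: leq_trans (mb j) _; rewrite mnmBE leq_subr.
  move=> jT; rewrite mT // mnmBE mnm1E; case: eqP => [ij|_].
    by have := iT; rewrite ij jT.
  by rewrite subn0.
Qed.

Lemma region_disj m :
  region b (i |: T) m -> region (b - U_(i))%MM T m -> false.
Proof.
move=> /regionP[_ /(_ i)]; rewrite setU11 => /(_ isT) mi.
move=> /regionP[/(_ i)]; rewrite mnmBE mnm1E eqxx mi subn1.
by rewrite leqNgt ltn_predL bi_gt0.
Qed.

Lemma region_low m1 m2 :
  region b (i |: T) m1 -> region (b - U_(i))%MM T m2 -> (m1 <= m2)%MM -> false.
Proof.
move=> /regionP[_ /(_ i)]; rewrite setU11 => /(_ isT) mi.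
move=> /regionP[/(_ i)]; rewrite mnmBE mnm1E eqxx subn1 => m2i _.
move=> /mnm_lepP/(_ i) /leq_trans/(_ m2i).
by rewrite mi leqNgt ltn_predL bi_gt0.
Qed.

Let convR := @region_convex b T.

Lemma region_acyclic_mid k :
  acyclic_at (region b (i |: T)) k -> acyclic_at (region (b - U_(i))%MM T) k ->
  acyclic_at (region b T) k.
Proof. exact: acyclic_mid region_split region_disj region_low convR k. Qed.

Lemma region_acyclic_quo k :
  acyclic_at (region b T) k.+1 -> acyclic_at (region (b - U_(i))%MM T) k ->
  acyclic_at (region b (i |: T)) k.+1.
Proof. exact: acyclic_quo region_split region_disj region_low convR k. Qed.

Lemma region_acyclic_quo0 :
  acyclic_at (region b T) 0 -> acyclic_at (region b (i |: T)) 0.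
Proof. exact: acyclic_quo0 region_split region_disj region_low. Qed.

Lemma region_acyclic_sub k :
  acyclic_at (region b (i |: T)) k.+1 -> acyclic_at (region b T) k ->
  acyclic_at (region (b - U_(i))%MM T) k.
Proof. exact: acyclic_sub region_split region_disj region_low convR k. Qed.

End RegionSplit.

(** The complex resolves a monomial ideal: in each multidegree b, the strand of
    degree b augmented by aug is exact, and I tells in which multidegrees the
    augmentation is nonzero. *)
Variables (aug : 'cV[K]_(rk 0)) (I : pred 'X_{1..n}).
Hypothesis C_aug0 : C 0 *m aug = 0.
Hypothesis aug_exact : forall b (v : 'rV_(rk 0)),
  v *m cut (region b set0) 0 = v -> v *m aug = 0 ->
  exists2 w, w *m cut (region b set0) 1 = w & v = w *m C 0.
Hypothesis C_exact : forall b i (v : 'rV_(rk i.+1)),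
  v *m cut (region b set0) i.+1 = v -> v *m C i = 0 ->
  exists2 w, w *m cut (region b set0) i.+2 = w & v = w *m C i.+1.
Hypothesis I_aug : forall b, I b <->
  exists2 v : 'rV_(rk 0), v *m cut (region b set0) 0 = v & v *m aug = 1%:M.

Lemma aug_notin b (v : 'rV_(rk 0)) :
  v *m cut (region b set0) 0 = v -> ~~ I b -> v *m aug = 0.
Proof.
move=> vb; apply: contraNeq => va; apply/I_aug.
have [a Ea] : exists a, v *m aug = a%:M.
  by exists ((v *m aug) 0 0); apply: mx11_scalar.
have a0 : a != 0 by apply: contra_neq va => a0; rewrite Ea a0 raddf0.
exists (a^-1 *: v); first by rewrite -scalemxAl vb.
by rewrite -scalemxAl Ea scale_scalar_mx mulVf.
Qed.

Lemma cut_le_C b i (v : 'rV_(rk i.+1)) : v *m cut (region b set0) i.+1 = v ->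
  v *m C i *m cut (region b set0) i = v *m C i.
Proof.
move/cutP=> vb; apply/cutP=> l lb; rewrite mxE big1 // => j _.
have [->|/C_homog lj] := eqVneq (C i j l) 0; first by rewrite mulr0.
rewrite vb ?mul0r //; apply: contra lb => /regionP[jb _].
apply/regionP; split=> [x|x]; last by rewrite in_set0.
exact: leq_trans (mnm_lepP lj x) (jb x).
Qed.

Lemma acyclic_set0S b k : acyclic_at (region b set0) k.+1.
Proof.
move=> v vb /=; rewrite cut_le_C // => v0.
by have [w wb ->] := C_exact vb v0; exists w; rewrite ?cut_le_C.
Qed.

Lemma acyclic_set0_0 b : acyclic_at (region b set0) 0 <-> ~~ I b.
Proof.
split=> [ac|Ib v vb _].
  apply/negP=> /I_aug[v vb va]; have [|w wb] := ac v vb.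
    by rewrite mulmx0 mul0mx.
  rewrite cut_le_C // => Ev; move: va; rewrite Ev -mulmxA C_aug0 mulmx0.
  by move/matrixP/(_ 0 0)/eqP; rewrite !mxE eqxx eq_sym oner_eq0.
have [w wb ->] := aug_exact vb (aug_notin vb Ib).
by exists w; rewrite ?cut_le_C.
Qed.

(** Multiplication by x_q from degree b - U_(q) to degree b is always injective
    on a monomial ideal; under the hypothesis it is bijective. *)
Lemma acyclic_set1 (b : 'X_{1..n}) q k :
  (0 < b q)%N -> (I b -> I (b - U_(q))%MM) ->
  acyclic_at (region b [set q]) k.
Proof.
rewrite -(setU0 [set q]) => bq Ibq.
have qn : q \notin set0 by rewrite in_set0.
have split0 := cut_split (region_split qn bq) (region_disj bq).
have q12 := cut12 (region_disj (T := set0) bq).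
have q21 := cut21 (region_disj (T := set0) bq).
set Q := region b set0 in split0 *; set Q1 := region b _ in split0 q12 q21 *.
set Q2 := region _ _ in split0 q12 q21.
have on1 i (v : 'rV_(rk i)) : v *m cut Q1 i = v -> v *m cut Q i = v.
  by move=> <-; rewrite split0 mulmxDr -!mulmxA cutK q12 mulmx0 addr0.
have on2 i (v : 'rV_(rk i)) : v *m cut Q2 i = v -> v *m cut Q i = v.
  by move=> <-; rewrite split0 mulmxDr -!mulmxA cutK q21 mulmx0 add0r.
(* It suffices that v - u is a boundary for some u supported on Q2. *)
have fin i (v : 'rV_(rk i)) (u : 'rV_(rk i)) (w : 'rV_(rk i.+1)) :
    v *m cut Q1 i = v -> u *m cut Q2 i = u -> w *m cut Q i.+1 = w ->
    v - u = w *m C i ->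
    exists2 w : 'rV_(rk i.+1), w *m cut Q1 i.+1 = w & v = w *m C i *m cut Q1 i.
  move=> v1 u2 wQ Ev; exists (w *m cut Q1 i.+1); first by rewrite mul_cut_id.
  have -> : w *m cut Q1 i.+1 = w - w *m cut Q2 i.+1.
    by rewrite -{2}wQ split0 mulmxDr addrK.
  rewrite !mulmxBl (cut2_C_cut1 (region_low bq)) subr0 -Ev mulmxBl v1.
  by rewrite -u2 -mulmxA q21 mulmx0 subr0.
case: k => [|[|k]].
(* At level 0, v is corrected by u so that its augmentation vanishes. *)
- move=> v v1 _; have vQ := on1 _ _ v1.
  have [u u2 vu] : exists2 u : 'rV_(rk 0),
      u *m cut Q2 0 = u & (v - u) *m aug = 0.
    have [/Ibq/I_aug[u u2 ua]|Ib] := boolP (I b).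
      exists ((v *m aug) 0 0 *: u); first by rewrite -scalemxAl u2.
      rewrite mulmxBl -scalemxAl ua [X in X - _]mx11_scalar.
      by rewrite scale_scalar_mx mulr1 subrr.
    by exists 0; rewrite ?mul0mx // subr0 (aug_notin vQ).
  have [|w wQ Ew] := aug_exact (b := b) _ vu.
    by rewrite mulmxBl vQ (on2 _ _ u2).
  exact: (fin _ _ _ _ v1 u2 wQ Ew).
(* At level 1, the image of v lies in the strand of degree b - U_(q), and it is
   the image of some u already there. *)
- move=> v v1 /= v0; have vQ := on1 _ _ v1.
  have u2 : v *m C 0 *m cut Q2 0 = v *m C 0.
    by rewrite -[RHS](cut_le_C vQ) split0 mulmxDr v0 add0r.
  have [|u u2' Eu] := aug_exact (b := (b - U_(q))%MM) u2.
    by rewrite -mulmxA C_aug0 mulmx0.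
  have [||w wQ Ew] := C_exact (b := b) (v := v - u).
  + by rewrite mulmxBl vQ (on2 _ _ u2').
  + by rewrite mulmxBl Eu subrr.
  exact: (fin _ _ _ _ v1 u2' wQ Ew).
- by apply: region_acyclic_quo => //; apply: acyclic_set0S.
Qed.

(** The hypothesis passes from T and b to T :\ r with b or b - U_(r), so the
    variables in T are added one at a time to the case of the single q. *)
Lemma acyclic_cone (b : 'X_{1..n}) q (T : {set 'I_n}) k :
  q \notin T -> (0 < b q)%N ->
  (forall b' : 'X_{1..n},
     (b' <= b)%MM -> (forall i, i \notin T -> b' i = b i) ->
     I b' -> I (b' - U_(q))%MM) ->
  acyclic_at (region b (q |: T)) k.
Proof.
have [m] := ubnP #|T|; elim: m => // m IH in T b k *.
rewrite ltnS => cT qT bq cone.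
have [T0|[r rT]] := set_0Vmem T.
  rewrite T0 setU0; apply: acyclic_set1 => //; apply: cone => //.
  exact: lepm_refl.
have rq : r != q by apply: contraNneq qT => <-.
have ET : q |: T = r |: (q |: (T :\ r)) by rewrite setUCA setD1K.
have cT' : (#|T :\ r| < m)%N.
  by apply: leq_trans cT; rewrite [X in (_ < X)%N](cardsD1 r) rT.
have qT' : q \notin T :\ r by rewrite !inE (negPf qT) andbF.
have acb k' : acyclic_at (region b (q |: (T :\ r))) k'.
  apply: IH => // b' le_b' eq_b'; apply: cone => // i iT.
  by apply: eq_b'; rewrite !inE (negPf iT) andbF.
have [br0|br] := posnP (b r).
  rewrite ET; apply: eq_acyclic (acb k) => x.
  by rewrite (region_eq0 _ br0).
have rT' : r \notin q |: (T :\ r) by rewrite !inE eqxx (negPf rq).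
rewrite ET; case: k => [|k]; first exact: region_acyclic_quo0 (acb _).
apply: region_acyclic_quo => //; apply: IH => //.
  by rewrite mnmBE mnm1E (negPf rq) subn0.
move=> b' le_b' eq_b'; apply: cone => [|i iT].
  exact: lepm_trans le_b' (lem_subr _ _).
rewrite eq_b' ?mnmBE ?mnm1E ?inE ?(negPf iT) ?andbF //.
by case: eqP => [ri|_]; [rewrite -ri rT in iT | rewrite subn0].
Qed.

Hypothesis C_min : forall i j l, sh j = sh l -> C i j l = 0.

(** With all variables divided out, all maps between the remaining basis vectors
    vanish. *)
Lemma acyclic_setT b k :
  acyclic_at (region b setT) k <-> ~ exists j : 'I_(rk k), sh j = b.
Proof.
have regT m : region b setT m = (m == b).
  apply/regionP/eqP=> [[_ h]|->]; last by split.
  by apply/mnmP=> i; apply: h; rewrite inE.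
split=> [ac [j jb]|nob v vb _].
  pose v : 'rV[K]_(rk k) := delta_mx 0 j.
  have [||w wb] := ac v.
  - apply/cutP=> l; rewrite regT mxE eqxx /=; case: (l =P j) => [->|//].
    by rewrite jb eqxx.
  - apply/rowP=> l; rewrite mul_cutE regT [RHS]mxE.
    case: eqP => [lb|]; last by rewrite mulr0.
    rewrite mulr1 -rowE mxE; case: (k) j jb l lb {v ac} => [|i] j jb l lb /=.
      by rewrite mxE.
    by rewrite C_min // jb lb.
  move/rowP/(_ j)/eqP; rewrite mul_cutE mxE !eqxx regT jb eqxx mulr1.
  rewrite mxE big1 ?oner_eq0 // => x _.
  move/cutP: wb => /(_ x); rewrite regT.
  case: eqP => [xb _|_ -> //]; last by rewrite mul0r.
  by rewrite C_min ?mulr0 // xb jb.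
exists 0; first by rewrite mul0mx.
rewrite !mul0mx; apply/rowP=> j; move/cutP: vb => -> //.
  by rewrite mxE.
by rewrite regT; apply/eqP=> jb; apply: nob; exists j.
Qed.

(** The variables of index at least q. *)
Definition upper q : {set 'I_n} := [set i : 'I_n | q <= i]%N.

Lemma upperS (q : 'I_n) : upper q = q |: upper q.+1.
Proof.
by apply/setP=> i; rewrite !inE leq_eqVlt (inj_eq val_inj) eq_sym.
Qed.

(** The hypothesis says that, for the multidegrees b' that differ from b only
    from q on, membership in I is decided by the greedy algorithm in state
    (lb, d) run on the support from q on. *)
Lemma acyclic_upper t m q : (q + m = n)%N -> forall (b : 'X_{1..n}) lb d k,
  (forall b' : 'X_{1..n}, (b' <= b)%MM ->
     (forall i : 'I_n, (i < q)%N -> b' i = b i) ->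
     I b' = spread_pick t lb d (supp_from b' q)) ->
  acyclic_at (region b (upper q)) k <->
    ~~ (sqfree_from b q && tor_shape t lb d k (supp_from b q)).
Proof.
elim: m q => [|m IH] q.
  rewrite addn0 => -> b lb d k Ib.
  have -> : upper n = set0 by apply/setP=> i; rewrite !inE leqNgt ltn_ord.
  have -> : sqfree_from b n by apply/forallP=> i; rewrite leqNgt ltn_ord.
  rewrite supp_from_end /=; case: k => [|k].
    rewrite andbT; have := Ib b (lepm_refl b) (fun _ _ => erefl).
    by rewrite supp_from_end /= => <-; apply: acyclic_set0_0.
  by rewrite andbF; split=> // _; apply: acyclic_set0S.
move=> qm b lb d k Ib; have ltqn : (q < n)%N by rewrite -qm; lia.
pose q0 := Ordinal ltqn; rewrite -[q]/(val q0) in qm Ib *.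
have qm' : (q0.+1 + m)%N = n by rewrite -addSnnS in qm.
have q0n : q0 \notin upper q0.+1 by rewrite inE ltnn.
have Ueq (b' : 'X_{1..n}) i : (val q0 < val i)%N ->
    (b' - U_(q0))%MM i = b' i.
  by move=> qi; rewrite mnmBE mnm1E -(inj_eq val_inj) ltn_eqF ?subn0.
have Uq (b' : 'X_{1..n}) : (b' - U_(q0))%MM q0 = (b' q0).-1.
  by rewrite mnmBE mnm1E eqxx subn1.
have Ult (b' : 'X_{1..n}) i : (val i < val q0)%N -> (b' - U_(q0))%MM i = b' i.
  by move=> qi; rewrite mnmBE mnm1E -(inj_eq val_inj) gtn_eqF ?subn0.
have supp_fromU (b' : 'X_{1..n}) :
    supp_from (b' - U_(q0))%MM q0.+1 = supp_from b' q0.+1.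
  by apply: eq_supp_from => i qi; rewrite Ueq.
rewrite sqfree_fromS upperS.
have [bq0|bq] := posnP (b q0).
  rewrite [supp_from b q0]supp_from_cons bq0 /=.
  rewrite -(IH _ qm' b lb d k) => [|b' le_b' eq_b'].
    by split; apply: eq_acyclic => x; rewrite region_eq0.
  rewrite Ib // => [|i iq]; last by apply: eq_b'; apply: ltnW.
  by rewrite supp_from_cons eq_b' // bq0.
(* The greedy algorithm ignores x_q, or has found everything, or x_q remains
   after one factor x_q has been removed. *)
have cone : [|| 1 < b q0, d == 0 | val q0 < lb]%N ->
    acyclic_at (region b (q0 |: upper q0.+1)) k.
  move=> cases; apply: acyclic_cone => // b' le_b' eq_b'.
  have eqlow i : (val i <= val q0)%N -> b' i = b i.
    by move=> iq; apply: eq_b'; rewrite inE -leqNgt.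
  have le_bU := lepm_trans (lem_subr b' U_(q0)%MM) le_b'.
  rewrite !Ib // => [|i iq|i iq]; [|by rewrite Ult // eqlow // ltnW |].
    rewrite !supp_from_cons Uq supp_fromU !eqlow // bq /=.
    case/or3P: cases => [bq1|/eqP->|qlb] => //.
    - by have -> : (0 < (b q0).-1)%N by lia.
    - by move=> _; case: ifP => // _; case: supp_from.
    - rewrite (leqNgt lb) qlb /= => /orP[/eqP->|a].
        by case: ifP => // _; case: supp_from.
      by case: ifP; rewrite //= (leqNgt lb) qlb a orbT.
  by rewrite eqlow // ltnW.
rewrite supp_from_cons bq /=.
have [bq1|bq1] := ltnP 1 (b q0).
  by split=> // _; apply: cone; rewrite bq1.
have [d0|d0] := posnP d.
  by rewrite andbF; split=> // _; apply: cone; rewrite d0 orbT.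
have [qlb|qlb] := ltnP q0 lb.
  by rewrite andbF; split=> // _; apply: cone; rewrite qlb !orbT.
have {}bq1 : b q0 = 1%N by lia.
clear cone; rewrite /=.
(* The remaining case: x_q is picked in degree b, which gives the middle term of
   the sequence, and is absent in degree b - U_(q0), which gives the sub. *)
have mid k' : acyclic_at (region b (upper q0.+1)) k' <->
    ~~ (sqfree_from b q0.+1 &&
        tor_shape t (q0 + t) d.-1 k' (supp_from b q0.+1)).
  apply: IH => // b' le_b' eq_b'.
  rewrite Ib // => [|i iq]; last by apply: eq_b'; apply: ltnW.
  by rewrite supp_from_cons eq_b' // bq /= qlb gtn_eqF.
have sub k' : acyclic_at (region (b - U_(q0))%MM (upper q0.+1)) k' <->
    ~~ (sqfree_from b q0.+1 && tor_shape t lb d k' (supp_from b q0.+1)).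
  rewrite -supp_fromU.
  have -> : sqfree_from b q0.+1 = sqfree_from (b - U_(q0))%MM q0.+1.
    by apply: eq_sqfree_from => i qi; rewrite Ueq.
  apply: IH => // b' le_b' eq_b'.
  rewrite Ib => [||i iq].
  - by rewrite supp_from_cons eq_b' // Uq bq1.
  - exact: lepm_trans le_b' (lem_subr _ _).
  - by rewrite eq_b' ?Ult // ltnW.
case: (sqfree_from b _) mid sub => /= mid sub; last first.
  split=> // _; case: k => [|k].
    by apply: region_acyclic_quo0 => //; apply/mid.
  by apply: region_acyclic_quo => //; [apply/mid | apply/sub].
split=> [ac|].
  (* The homology of the middle term and that of the sub are concentrated in
     different degrees, by the size of the support. *)
  apply/negP=> /orP[X|/andP[k0 Y]].
    have := X; apply/negP/mid/(region_acyclic_mid (i := q0)) => //.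
    apply/sub; apply/negP=> /tor_shape_size; rewrite (tor_shape_size X); lia.
  case: k => [//|k] in ac Y k0 *.
  have := Y; apply/negP/sub; apply: region_acyclic_sub ac _ => //.
  apply/mid; apply/negP=> /tor_shape_size.
  by rewrite (tor_shape_size Y) /=; lia.
rewrite negb_or => /andP[X Y]; case: k => [|k] in X Y *.
  by apply: region_acyclic_quo0 => //; apply/mid.
by apply: region_acyclic_quo => //; [apply/mid | apply/sub].
Qed.

(** The multidegrees of the basis vectors at level k, when I is given by the
    greedy algorithm. *)
Lemma shift_spec t d k b :
  (forall b' : 'X_{1..n}, I b' = spread_pick t 0 d (supp_from b' 0)) ->
  (exists j : 'I_(rk k), sh j = b) <->
    sqfree_from b 0 && tor_shape t 0 d k (supp_from b 0).
Proof.
move=> Iacc.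
have := @acyclic_upper t n 0 (add0n n) b 0%N d k (fun b' _ _ => Iacc b').
have -> : upper 0 = setT by apply/setP=> i; rewrite !inE.
rewrite acyclic_setT; case: (_ && _) => /= h; split=> //.
  move=> _; have [|nob] := boolP [exists j : 'I_(rk k), sh j == b].
    by case/existsP=> j /eqP jb; exists j.
  by case/h: (fun ex : exists j, sh j = b => let: ex_intro j jb := ex in
    negP nob (introT existsP (ex_intro _ j (introT eqP jb)))).
by have /(_ isT) nob := h.2.
Qed.

End Strands.

(** * From multigraded matrices to scalar matrices *)

Lemma mcoeffMX_sub (R : comNzRingType) n (p : {mpoly R[n]}) (m b : 'X_{1..n}) :
  (p * 'X_[m])@_b = if (m <= b)%MM then p@_(b - m) else 0.
Proof.
case: ifP => [le_mb|/negP nle_mb].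
  by rewrite -{1}(submK le_mb) addmC mcoeffMX.
apply/eqP; rewrite mcoeff_eq0; apply/negP.
move=> /msuppM_le /allpairsP[[m1 m2] /= [_]].
by rewrite msuppX mem_seq1 => /eqP-> Eb; apply: nle_mb; rewrite Eb lem_addl.
Qed.

Section Homogeneous.

Variables (K : fieldType) (n p q : nat).
Variables (sp : 'I_p -> 'X_{1..n}) (sq : 'I_q -> 'X_{1..n}).
Variable M : 'M[{mpoly K[n]}]_(p, q).
Hypothesis M_homog : forall j l m, m \in msupp (M j l) -> (m + sq l)%MM = sp j.

(** The entries of a multigraded matrix are scalar multiples of the monomials
    prescribed by the multidegrees; these are the scalars.  Where the subtraction
    sp j - sq l truncates, the entry is 0 by homogeneity. *)
Definition scalar_part : 'M[K]_(p, q) :=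
  \matrix_(j, l) (M j l)@_(sp j - sq l).

Lemma scalar_partE j l : M j l = scalar_part j l *: 'X_[sp j - sq l].
Proof.
apply/mpolyP=> m; rewrite mcoeffZ mcoeffX mxE.
case: eqP => [<-|nm]; first by rewrite mulr1.
rewrite mulr0; apply/eqP; rewrite mcoeff_eq0; apply/negP=> /M_homog Em.
by apply: nm; rewrite -Em addmK.
Qed.

Lemma scalar_part_le j l : scalar_part j l != 0 -> (sq l <= sp j)%MM.
Proof. by rewrite mxE -mcoeff_msupp => /M_homog <-; rewrite lem_addl. Qed.

End Homogeneous.

Section Strand.

Variables (K : fieldType) (n : nat) (b : 'X_{1..n}).

(** The element of multidegree b with the given coordinates: it is meaningful
    when v is supported on the basis vectors of multidegree at most b. *)
Definition homogenize p (sp : 'I_p -> 'X_{1..n}) (v : 'rV[K]_p) :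
    'rV[{mpoly K[n]}]_p :=
  \row_j (v 0 j *: 'X_[b - sp j]).

(** The coordinates of the component of multidegree b of V. *)
Definition degree_part p (sp : 'I_p -> 'X_{1..n}) (V : 'rV[{mpoly K[n]}]_p) :
    'rV[K]_p :=
  \row_j (if (sp j <= b)%MM then (V 0 j)@_(b - sp j) else 0).

(** v is supported on the basis vectors of multidegree at most b. *)
Definition below p (sp : 'I_p -> 'X_{1..n}) (v : 'rV[K]_p) :=
  forall j, ~~ (sp j <= b)%MM -> v 0 j = 0.

Lemma below_degree_part p (sp : 'I_p -> 'X_{1..n}) V :
  below sp (degree_part sp V).
Proof. by move=> j /negPf bj; rewrite mxE bj. Qed.

Lemma homogenizeK p (sp : 'I_p -> 'X_{1..n}) v :
  below sp v -> degree_part sp (homogenize sp v) = v.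
Proof.
move=> vb; apply/rowP=> j; rewrite !mxE.
by case: ifPn => [_|/vb-> //]; rewrite mcoeffZ mcoeffX eqxx mulr1.
Qed.

Variables (p q : nat).
Variables (sp : 'I_p -> 'X_{1..n}) (sq : 'I_q -> 'X_{1..n}).
Variable M : 'M[{mpoly K[n]}]_(p, q).
Hypothesis M_homog : forall j l m, m \in msupp (M j l) -> (m + sq l)%MM = sp j.

Let c := scalar_part sp sq M.

Lemma homogenize_mul v : below sp v ->
  homogenize sp v *m M = homogenize sq (v *m c).
Proof.
move=> vb; apply/rowP=> l; rewrite !mxE scaler_suml; apply: eq_bigr => j _.
rewrite mxE (scalar_partE M_homog) -/c -scalerAl -scalerAr scalerA.
have [jb|/vb->] := boolP (sp j <= b)%MM; last by rewrite !mul0r !scale0r.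
have [->|/(scalar_part_le M_homog) lj] := eqVneq (c j l) 0.
  by rewrite !mulr0 !scale0r.
rewrite -mpolyXD; congr (_ *: 'X_[_]); apply/mnmP=> i.
by rewrite mnmDE !mnmBE; have := mnm_lepP jb i; have := mnm_lepP lj i; lia.
Qed.

Lemma degree_part_mul W :
  degree_part sq (W *m M) = degree_part sp W *m c.
Proof.
apply/rowP=> l; rewrite !mxE; case: ifPn => lb; last first.
  rewrite big1 // => j _; rewrite mxE.
  have [->|/(scalar_part_le M_homog) lj] := eqVneq (c j l) 0.
    by rewrite mulr0.
  case: ifP => [jb|]; last by rewrite mul0r.
  by rewrite (lepm_trans lj jb) in lb.
rewrite raddf_sum; apply: eq_bigr => j _; rewrite mxE.
rewrite (scalar_partE M_homog) -/c -scalerAr [LHS]mcoeffZ mcoeffMX_sub mulrC.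
have [->|/(scalar_part_le M_homog) lj] := eqVneq (c j l) 0.
  by rewrite !mulr0.
have -> : (sp j - sq l <= b - sq l)%MM = (sp j <= b)%MM.
  apply/mnm_lepP/mnm_lepP=> h i; have := h i; have := mnm_lepP lj i;
  by have := mnm_lepP lb i; rewrite !mnmBE; lia.
case: ifP => [jb|_]; last by rewrite !mul0r.
suff -> : (b - sq l - (sp j - sq l))%MM = (b - sp j)%MM by [].
apply/mnmP=> i.
by rewrite !mnmBE; have := mnm_lepP jb i; have := mnm_lepP lj i; lia.
Qed.

End Strand.

Lemma max_ideal_mcoeff0 (K : fieldType) n (p : {mpoly K[n]}) :
  max_ideal p -> p@_0 = 0.
Proof.
case=> r rX ->; rewrite raddf_sum big_seq big1 // => x /rX[i ->] /=.
by rewrite mcoeffMX_sub lep1mP mnm0E.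
Qed.

Section ScalarResolution.

Variables (K : fieldType) (n : nat) (F : mg_complex K n).
Variable I : {mpoly K[n]} -> Prop.
Hypothesis F_res : minimal_mg_free_resolution F I.

Let sh i := @mg_shift K n F i.

(** The scalar complex of a minimal multigraded free resolution. *)
Definition scalar_diff i := scalar_part (@sh i.+1) (@sh i) (mg_diff F i).

(** The augmentation is treated as one more differential, with target the free
    module of rank 1 generated in multidegree 0. *)
Definition scalar_aug : 'cV[K]_(mg_rank F 0) :=
  scalar_part (@sh 0%N) (fun _ : 'I_1 => 0%MM) (mg_aug F).

Let diff_homog i (j : 'I_(mg_rank F i.+1)) (l : 'I_(mg_rank F i)) m :
  m \in msupp (mg_diff F i j l) -> (m + @sh i l)%MM = @sh i.+1 j.
Proof. by case: F_res => -[_ h] _ _; apply: h. Qed.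

Let aug_homog (j : 'I_(mg_rank F 0)) (l : 'I_1) m :
  m \in msupp (mg_aug F j l) -> (m + 0)%MM = @sh 0%N j.
Proof. by rewrite ord1 addm0; case: F_res => -[h _] _ _; apply: h. Qed.

Let cut_region0 i b (v : 'rV[K]_(mg_rank F i)) :
  v *m cut K sh (region b set0) i = v <-> below b (@sh i) v.
Proof.
have reg m : region b set0 m = (m <= b)%MM.
  apply/regionP/idP=> [[/mnm_lepP//]|/mnm_lepP mb]; split=> // x.
  by rewrite in_set0.
rewrite cutP; split=> vb j; first by rewrite -reg; apply: vb.
by rewrite reg; apply: vb.
Qed.

Let below_delta i (j : 'I_(mg_rank F i)) :
  below (sh j) (@sh i) (delta_mx 0 j : 'rV[K]_ _).
Proof.
move=> l; rewrite mxE eqxx /=; case: (l =P j) => [->|//].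
by rewrite lepm_refl.
Qed.

Let homogenize0 b r (s : 'I_r -> 'X_{1..n}) : homogenize b s (0 : 'rV[K]_r) = 0.
Proof. by apply/rowP=> l; rewrite !mxE scale0r. Qed.

Let degree_part0 b r (s : 'I_r -> 'X_{1..n}) :
  degree_part b s (0 : 'rV[{mpoly K[n]}]_r) = 0.
Proof. by apply/rowP=> l; rewrite !mxE mcoeff0; case: ifP. Qed.

Lemma scalar_diff_le i j l : scalar_diff i j l != 0 -> (sh l <= sh j)%MM.
Proof. exact: scalar_part_le (@diff_homog i) j l. Qed.

(** The identity may be checked on basis vectors, and the j-th basis vector
    lives in the strand of multidegree sh j. *)
Lemma scalar_diff_diff0 i : scalar_diff i.+1 *m scalar_diff i = 0.
Proof.
case: F_res => _ [_ _ exdiff] _.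
apply/row_matrixP=> j; rewrite row0 rowE mulmxA.
rewrite -(homogenizeK (@below_delta _ j)) -!(degree_part_mul _ (@diff_homog _)).
set V := homogenize _ _ _.
have -> : V *m mg_diff F i.+1 *m mg_diff F i = 0 by apply/exdiff; eexists.
exact: degree_part0.
Qed.

Lemma scalar_diff_aug0 : scalar_diff 0 *m scalar_aug = 0.
Proof.
case: F_res => _ [_ exaug _] _.
apply/row_matrixP=> j; rewrite row0 rowE mulmxA.
rewrite -(homogenizeK (@below_delta _ j)) -(degree_part_mul _ (@diff_homog _)).
rewrite -(degree_part_mul _ aug_homog); set V := homogenize _ _ _.
have -> : V *m mg_diff F 0 *m mg_aug F = 0 by apply/exaug; eexists.
exact: degree_part0.
Qed.

Lemma scalar_aug_exact b (v : 'rV[K]_(mg_rank F 0)) :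
  v *m cut K sh (region b set0) 0 = v -> v *m scalar_aug = 0 ->
  exists2 w, w *m cut K sh (region b set0) 1 = w & v = w *m scalar_diff 0.
Proof.
case: F_res => _ [_ exaug _] _ /cut_region0 vb va.
have /exaug[W EW] : homogenize b (@sh 0%N) v *m mg_aug F = 0.
  by rewrite (homogenize_mul aug_homog vb) va homogenize0.
exists (degree_part b (@sh 1%N) W); first exact/cut_region0/below_degree_part.
by rewrite -(degree_part_mul _ (@diff_homog _)) -EW homogenizeK.
Qed.

Lemma scalar_diff_exact b i (v : 'rV[K]_(mg_rank F i.+1)) :
  v *m cut K sh (region b set0) i.+1 = v -> v *m scalar_diff i = 0 ->
  exists2 w, w *m cut K sh (region b set0) i.+2 = w & v = w *m scalar_diff i.+1.
Proof.
case: F_res => _ [_ _ exdiff] _ /cut_region0 vb va.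
have /exdiff[W EW] : homogenize b (@sh i.+1) v *m mg_diff F i = 0.
  by rewrite (homogenize_mul (@diff_homog _) vb) va homogenize0.
exists (degree_part b (@sh i.+2) W); first exact/cut_region0/below_degree_part.
by rewrite -(degree_part_mul _ (@diff_homog _)) -EW homogenizeK.
Qed.

Lemma scalar_augP b : I 'X_[b] <->
  exists2 v, v *m cut K sh (region b set0) 0 = v & v *m scalar_aug = 1%:M.
Proof.
case: F_res => _ [exI _ _] _; rewrite exI.
split=> [[V EV]|[v /cut_region0 vb va]].
  exists (degree_part b (@sh 0%N) V); first exact/cut_region0/below_degree_part.
  rewrite -(degree_part_mul _ aug_homog); apply/rowP=> l; rewrite !mxE ord1.
  move: EV; rewrite mxE => ->; rewrite mcoeffX subm0 eqxx.
  by case: mnm_lepP => // -[] i; rewrite mnm0E.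
exists (homogenize b (@sh 0%N) v); rewrite (homogenize_mul aug_homog vb) va.
by rewrite !mxE eqxx scale1r subm0.
Qed.

(** Minimality kills the scalar entries between basis vectors of the same
    multidegree: such an entry of the differential is a constant polynomial. *)
Lemma scalar_diff_min i (j : 'I_(mg_rank F i.+1)) (l : 'I_(mg_rank F i)) :
  sh j = sh l -> scalar_diff i j l = 0.
Proof.
case: F_res => _ _ minF jl; rewrite mxE jl.
have -> : (sh l - sh l)%MM = 0%MM.
  by apply/mnmP=> x; rewrite mnmBE subnn mnm0E.
exact: max_ideal_mcoeff0 (minF _ _ _).
Qed.

End ScalarResolution.

(** * Monomial ideals and squarefree monomials *)

Lemma eq_ideal_gen (A : comNzRingType) (G G' : A -> Prop) :
  (forall x, G x <-> G' x) -> forall p, ideal_gen G p <-> ideal_gen G' p.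
Proof. by move=> eqG p; split=> -[r rG ->]; exists r => // x /rG/eqG. Qed.

Lemma ideal_gen_monomial (K : fieldType) n (G : 'X_{1..n} -> Prop) b :
  ideal_gen (fun q : {mpoly K[n]} => exists2 m, G m & q = 'X_[m]) 'X_[b] <->
  exists2 m, G m & (m <= b)%MM.
Proof.
split=> [[r rG Eb]|[m Gm le_mb]]; last first.
  exists [:: ('X_[b - m], 'X_[m])]; last by rewrite big_seq1 -mpolyXD submK.
  by move=> x; rewrite mem_seq1 => /eqP->; exists m.
have [/hasP[x xr xb]|] := boolP (has (fun x : _ * _ => (x.1 * x.2)@_b != 0) r).
  have [m Gm Ex] := rG x xr; exists m => //.
  by move: xb; rewrite Ex mcoeffMX_sub; case: ifP; rewrite ?eqxx.
rewrite -all_predC => /allP r0.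
have := mcoeffX K b b; rewrite Eb raddf_sum big_seq big1 => [/eqP|x xr].
  by rewrite eqxx eq_sym oner_eq0.
by apply/eqP; have := r0 x xr; rewrite /= negbK.
Qed.

(** The exponent of the product of the variables listed in s. *)
Definition seq_mnm n (s : seq 'I_n) : 'X_{1..n} := (\sum_(i <- s) U_(i))%MM.

Lemma seq_monomialE (K : fieldType) n (s : seq 'I_n) :
  seq_monomial K s = 'X_[seq_mnm s].
Proof.
rewrite /seq_monomial /seq_mnm; elim: s => [|i s IH].
  by rewrite !big_nil mpolyX0.
by rewrite !big_cons mpolyXD IH.
Qed.

Lemma seq_mnmE n (s : seq 'I_n) i : seq_mnm s i = count_mem i s.
Proof.
rewrite mnm_sumE; elim: s => [|j s IH]; first by rewrite big_nil.
by rewrite big_cons IH mnm1E.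
Qed.

Lemma small_gapsE n t (s : seq 'I_n) :
  small_gaps t s = short_gaps t (map val s).
Proof.
rewrite /small_gaps -(size_map val); elim: (map val s) => //= x l <-.
case: l => //= y l; congr (_ + _)%N.
by rewrite (iotaDl 1 0) count_map.
Qed.

Lemma seq_mnm_sorted n (s : seq 'I_n) :
  sorted (fun i j : 'I_n => i < j)%N s ->
  sqfree_from (seq_mnm s) 0 /\ supp_from (seq_mnm s) 0 = map val s.
Proof.
move=> sS; have tr : transitive (fun i j : 'I_n => i < j)%N.
  by move=> j i k; apply: ltn_trans.
have us : uniq s by apply: sorted_uniq sS => // i; apply: ltnn.
split; first by apply/forallP=> i; rewrite seq_mnmE count_uniq_mem // leq_b1.
apply: (irr_sorted_eq ltn_trans ltnn) => [||x].
- exact: supp_from_sorted.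
- by rewrite sorted_map.
apply/idP/mapP=> [|[i si ->]]; last first.
  by rewrite mem_supp_from seq_mnmE -has_count has_pred1.
move=> xs; have ltxn : (x < n)%N by move: xs; rewrite mem_filter mem_iota; lia.
exists (Ordinal ltxn) => //.
move: xs; rewrite -[x]/(nat_of_ord (Ordinal ltxn)) mem_supp_from seq_mnmE.
by rewrite -has_count has_pred1.
Qed.

Lemma sqfree_seq_mnm n (b : 'X_{1..n}) : sqfree_from b 0 ->
  exists2 s, sorted (fun i j : 'I_n => i < j)%N s & b = seq_mnm s.
Proof.
move=> /forallP sb; exists [seq i <- enum 'I_n | 0 < b i]%N.
  apply: sorted_filter; first by move=> j i k; apply: ltn_trans.
  by have := iota_ltn_sorted 0 n; rewrite -val_enum_ord sorted_map.
have us : uniq [seq i <- enum 'I_n | 0 < b i]%N.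
  by rewrite filter_uniq // enum_uniq.
apply/mnmP=> i; rewrite seq_mnmE count_uniq_mem //.
by rewrite mem_filter mem_enum andbT; have := sb i; case: (b i) => [|[|]].
Qed.

Lemma ord_seqP n (l : seq nat) : all (fun x => x < n)%N l ->
  exists s : seq 'I_n, map val s = l.
Proof.
elim: l => [|x l IH] /=; first by exists [::].
by case/andP=> lt_xn /IH[s <-]; exists (Ordinal lt_xn :: s).
Qed.

(** A monomial lies in the t-spread Veronese ideal when its support contains d
    elements at mutual distance at least t. *)
Lemma veronese_monomial (K : fieldType) n d t (b : 'X_{1..n}) : (0 < t)%N ->
  veronese_ideal d t ('X_[b] : {mpoly K[n]}) <->
    spread_pick t 0 d (supp_from b 0).
Proof.
move=> t_gt0.
pose G m := exists2 s : seq 'I_n, size s = d /\ t_spread t s & m = seq_mnm s.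
have -> : veronese_ideal d t ('X_[b] : {mpoly K[n]}) <->
    exists2 m, G m & (m <= b)%MM.
  rewrite -(ideal_gen_monomial K G b); apply: eq_ideal_gen => x; split.
    case=> s [sd ts ->]; exists (seq_mnm s); first by exists s.
    exact: seq_monomialE.
  by case=> m [s [sd ts] ->] ->; exists s; rewrite seq_monomialE.
have sub_sorted (s : seq 'I_n) :
    t_spread t s = sorted (fun x y => x + t <= y)%N (map val s).
  rewrite sorted_map; apply: eq_sorted => i j /=.
  by apply/andP/idP=> [[]|]; lia.
have l_sorted := supp_from_sorted b 0.
split=> [[m [s [sd ts] ->] sb]|/(spread_pickP _ _ t_gt0 l_sorted)].
  apply/spread_pickP=> //.
  exists (map val s).
  split; rewrite ?size_map -?sub_sorted //; first exact/allP.
  move=> _ /mapP[i si ->]; rewrite mem_supp_from /=.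
  by apply: leq_trans (mnm_lepP sb i); rewrite seq_mnmE -has_count has_pred1.
case=> l [ld lS _ lb].
have [|s Es] := @ord_seqP n l.
  by apply/allP=> x /lb; rewrite mem_filter mem_iota; lia.
exists (seq_mnm s).
  exists s => //; rewrite sub_sorted Es; split=> //.
  by rewrite -ld -Es size_map.
have us : uniq s.
  rewrite -(map_inj_uniq val_inj) Es; apply: sorted_uniq lS => x.
    by move=> y z; lia.
  by lia.
apply/mnm_lepP=> i; rewrite seq_mnmE count_uniq_mem //.
case: (boolP (i \in s)) => // si.
by have := lb (val i); rewrite -Es map_f // mem_supp_from => /(_ isT).
Qed.

Theorem theorem5p1 (K : fieldType) (n d t : nat)
  (n_gt0 : (0 < n)%N) (d_gt0 : (0 < d)%N) (t_gt0 : (0 < t)%N)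
  (d_le_n : (d <= n)%N) (t_le_n : (t <= n)%N)
  (F : mg_complex K n)
  (F_res : minimal_mg_free_resolution F (@veronese_ideal K n d t))
  (k : nat) (p : {mpoly K[n]}) :
  homological_shift_ideal F k p <-> few_small_gaps_ideal d t k p.
Proof.
pose I : pred 'X_{1..n} := fun b => spread_pick t 0 d (supp_from b 0).
have I_aug b : I b <-> exists2 v,
    v *m cut K (@mg_shift K n F) (region b set0) 0 = v
    & v *m scalar_aug F = 1%:M.
  by rewrite -(veronese_monomial K d b t_gt0) (scalar_augP F_res).
have spec b := shift_spec (scalar_diff_le F_res) (scalar_diff_diff0 F_res)
  (scalar_diff_aug0 F_res) (scalar_aug_exact F_res)
  (scalar_diff_exact F_res) I_aug (scalar_diff_min F_res) k b
  (fun _ => erefl).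
apply: eq_ideal_gen => x; split=> [[j ->]|[s [sd sS sg ->]]].
  have /spec/andP[/sqfree_seq_mnm[s sS Eb]] :
    exists j', @mg_shift K n F k j' = mg_shift j by exists j.
  rewrite Eb; have [_ ->] := seq_mnm_sorted sS.
  rewrite tor_shape_gapsE // ?sorted_map //; last exact/allP.
  rewrite size_map -small_gapsE => /andP[/eqP sd sg].
  by exists s; rewrite seq_monomialE.
have [sq Es] := seq_mnm_sorted sS.
have [|j Ej] := (spec (seq_mnm s)).2; last first.
  by exists j; rewrite seq_monomialE -Ej.
rewrite sq Es tor_shape_gapsE // ?sorted_map //; last exact/allP.
by rewrite size_map sd eqxx -small_gapsE.
Qed.
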